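(* Consider the half-orthant model on $\mathbb{Z}^d$, $d\ge2$, and let $p>p_1$, with $p_1$ as described in the context. For each $v\in Z:=\{y\in\mathbb{Z}^d: y\cdot e_1=0\}$ there exists a deterministic $\zeta(v)\in\mathbb{R}$ such that $$n^{-1}L_{nv}\to\zeta(v),\qquad \mathbb{P}_p\text{-almost surely as } n\to\infty .$$
   Context: Half-orthant model: let $e_1,\dots,e_d$ be the canonical basis vectors, $\mathcal{E}_+=\{e_1,\dots,e_d\}$, $\mathcal{E}_-=\{-e_1,\dots,-e_d\}$, $\mathcal{E}=\mathcal{E}_+\cup\mathcal{E}_-$. For $p\in[0,1]$, the random sets $(\mathcal{G}_x)_{x\in\mathbb{Z}^d}$ are i.i.d. with $\mathcal{G}_x=\mathcal{E}_+$ with probability $p$ and $\mathcal{G}_x=\mathcal{E}$ with probability $1-p$; their law is $\mathbb{P}_p$. From each site $x$ there are arrows to $x+e$, $e\in\mathcal{G}_x$. $\mathcal{C}_o\subset\mathbb{Z}^d$ is the set of sites that can be reached from the origin $o$ by following arrows (including $o$). For $x\in\mathbb{Z}^d$, $L_x:=\inf\{k\in\mathbb{Z}: x+ke_1\in\mathcal{C}_o\}$. The constant $p_1=p_1(d)<1$: write $\boldsymbol{1}=\sum_{i=1}^d e_i$, $\beta_n(u)=\inf\{k\in\mathbb{Z}:k\boldsymbol{1}+nu\in\mathcal{C}_o\}$, $O_r=\{x\in\mathbb{R}^d:\|x\|_\infty\le r\}$, $sH=\{sx:x\in H\}$; the positive orthant is the set of points with all coordinates nonnegative. By the shape theorem for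 this model, there is a $p_1<1$ such that for all $p>p_1$: (a) for each $u\in\mathbb{Z}^d$ there is a deterministic $\gamma(u)$ with $\beta_n(u)/n\to\gamma(u)$ $\mathbb{P}_p$-a.s.; (b) for $r\in\mathbb{Z}_+$, $u,w\in\mathbb{Z}^d$: $\gamma(u+w)\le\gamma(u)+\gamma(w)$, $\gamma(ru)=r\gamma(u)$, $\gamma(u+r\boldsymbol{1})=\gamma(u)-r$, $\gamma$ is symmetric under permutation of coordinates, $\gamma(u)\ge0$ if $u\cdot\boldsymbol{1}\le0$, $\gamma(u)\le0$ if $u$ lies in the positive orthant; (c) $\gamma$ extends to a Lipschitz map $\mathbb{R}^d\to\mathbb{R}$ with the properties in (b) for $r\in[0,\infty)$, $u,w\in\mathbb{R}^d$; (d) $C=\{z\in\mathbb{R}^d:\gamma(z)\le0\}$ is a closed convex cone, symmetric under permutations of coordinates, containing the positive orthant and contained in $\{z:z\cdot\boldsymbol{1}\ge0\}$; (e) for every $\epsilon>0$ and $r\in[0,\infty)$, $\mathbb{P}_p$-a.s. for all sufficiently large (random) $n$, $O_r\cap\frac1n\mathcal{C}_o\subset O_\epsilon+C$ and $O_r\cap C\subset O_\epsilon+\frac1n\mathcal{C}_o$. Here $p_1$ denotes such a constant.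
   Formalization: The formal theorem also assumes p < 1: at p = 1 the cluster C_o is a.s. the positive orthant, so for v = -e_2 every L_{nv} with n ≥ 1 is the infimum of the empty set and no real ζ(v) exists. *)

(* Defs.v *)
From mathcomp Require Export all_boot all_order all_algebra.
From mathcomp Require Export perm.
From mathcomp Require Export all_classical all_reals all_analysis.
Export numFieldNormedType.Exports.
Export Order.TTheory GRing.Theory Num.Theory.

Set Implicit Arguments.
Unset Strict Implicit.
Unset Printing Implicit Defensive.

Local Open Scope classical_set_scope.
Local Open Scope ring_scope.

Notation site d := 'rV[int]_d.

Definition dot (S : pzRingType) (d : nat) (u w : 'rV[S]_d) : S :=
  \sum_i u 0 i * w 0 i.

(* The first basis vector (coordinates are numbered from 0); writing it with a
   test on the value of the index makes it meaningful for every d. *)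
Definition e1 (d : nat) : site d := \row_i (i == 0%N :> nat)%:R.

Definition E_plus (d : nat) : set (site d) :=
  [set delta_mx 0 i | i in [set: 'I_d]].

Definition E_minus (d : nat) : set (site d) :=
  [set - delta_mx 0 i | i in [set: 'I_d]].

(* An environment records at each site x which of its two values G_x takes:
   [true] stands for E_+ and [false] for E. *)
Definition environment (d : nat) : Type := site d -> bool.

Definition G (d : nat) (omega : environment d) (x : site d) : set (site d) :=
  if omega x then @E_plus d else @E_plus d `|` @E_minus d.

Definition C_o (d : nat) (omega : environment d) : set (site d) :=
  [set y | exists2 s : seq (site d),
     path (fun x x' => x' - x \in G omega x) 0 s & y = last 0 s].

(* The product sigma-algebra is generated by the one-site events. *)
Definition site_events (d : nat) : set (set (environment d)) :=
  [set A | exists (x : site d) (B : set bool), A = [set omega | B (omega x)]].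

Definition env_space (d : nat) := g_sigma_algebraType (@site_events d).

(* P is the product of Bernoulli(p) measures over Z^d, i.e. under P the
   coordinates are i.i.d. and equal to [true] with probability p. For p in
   [0, 1] this determines P. *)
Definition half_orthant_law (R : realType) (d : nat) (p : R)
    (P : probability (env_space d) R) : Prop :=
  forall (s : seq (site d)) (B : site d -> set bool), uniq s ->
    P [set omega | forall x, x \in s -> B x (omega x)] =
    (\prod_(x <- s) bernoulli_prob p (B x))%E.

(* The infima are taken in the extended reals, so inf of the empty set is +oo
   and the inf of a set unbounded below is -oo. *)
Definition L (R : realType) (d : nat) (omega : environment d) (x : site d)
    : \bar R :=
  ereal_inf [set (k%:~R)%:E | k in [set k : int |
    C_o omega (x + k *: e1 d)]].

Definition beta (R : realType) (d : nat) (omega : environment d)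
    (n : nat) (u : site d) : \bar R :=
  ereal_inf [set (k%:~R)%:E | k in [set k : int |
    C_o omega (k *: const_mx 1 + u *+ n)]].

(* Used with S = int, emb = intr (for gamma on Z^d) and with S = R, emb = id
   (for its extension to R^d). *)
Record gamma_properties (R : realType) (S : numDomainType) (emb : S -> R)
    (d : nat) (gamma : 'rV[S]_d -> R) : Prop := {
  gamma_subadditive : forall u w : 'rV[S]_d, gamma (u + w) <= gamma u + gamma w ;
  gamma_homogeneous : forall (r : S) (u : 'rV[S]_d), 0 <= r ->
    gamma (r *: u) = emb r * gamma u ;
  gamma_diagonal : forall (r : S) (u : 'rV[S]_d), 0 <= r ->
    gamma (u + r *: const_mx 1) = gamma u - emb r ;
  gamma_symmetric : forall (sigma : 'S_d) (u : 'rV[S]_d),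
    gamma (col_perm sigma u) = gamma u ;
  gamma_ge0 : forall u : 'rV[S]_d, dot u (const_mx 1) <= 0 -> 0 <= gamma u ;
  gamma_le0 : forall u : 'rV[S]_d, (forall i, 0 <= u 0 i) -> gamma u <= 0
}.

Record cone_properties (R : realType) (d : nat) (C : set 'rV[R]_d) : Prop := {
  cone_closed : closed C ;
  cone_convex : convex_set (C : set (convex_lmodType 'rV[R]_d)) ;
  cone_scale : forall (r : R) (z : 'rV[R]_d), 0 <= r -> C z -> C (r *: z) ;
  cone_symmetric : forall (sigma : 'S_d) (z : 'rV[R]_d), C z -> C (col_perm sigma z) ;
  cone_orthant : forall z : 'rV[R]_d, (forall i, 0 <= z 0 i) -> C z ;
  cone_halfspace : forall z : 'rV[R]_d, C z -> 0 <= dot z (const_mx 1)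
}.

(* The library norm on 'rV[R]_d is the sup norm. *)
Definition box (R : realType) (d : nat) (r : R) : set 'rV[R]_d :=
  [set x | `|x| <= r].

Definition scaled_C_o (R : realType) (d : nat) (omega : environment d)
    (n : nat) : set 'rV[R]_d :=
  [set n%:R^-1 *: map_mx intr x | x in C_o omega].

Definition minkowski (R : realType) (d : nat) (A B : set 'rV[R]_d)
    : set 'rV[R]_d :=
  [set a + b | a in A & b in B].

(* The conclusions of the shape theorem, for the environment law P. *)
Definition shape_property (R : realType) (d : nat)
    (P : probability (env_space d) R) : Prop :=
  exists (gamma : site d -> R) (gammaR : 'rV[R]_d -> R),
  let C := [set z | gammaR z <= 0] in
  [/\ forall u, {ae P, forall omega,
        (fun n : nat => (n%:R^-1)%:E * beta R omega n u)%E @ \oo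
          --> (gamma u)%:E},
      gamma_properties intr gamma,
      [/\ forall u, gammaR (map_mx intr u) = gamma u,
          lipschitz (gammaR : 'rV[R]_d -> R^o)
        & gamma_properties id gammaR],
      cone_properties C
    & forall epsilon r : R, 0 < epsilon -> 0 <= r ->
        {ae P, forall omega, \forall n \near \oo,
          box r `&` scaled_C_o omega n `<=` minkowski (box epsilon) C /\
          box r `&` C `<=` minkowski (box epsilon) (scaled_C_o omega n)}].

Definition shape_threshold (R : realType) (d : nat) (p1 : R) : Prop :=
  p1 < 1 /\
  forall p : R, 0 <= p <= 1 -> p1 < p ->
  forall P : probability (env_space d) R,
    half_orthant_law p P -> shape_property P.

(* Main.v *)
(* C_o is stable under adding vectors of the positive orthant, so L_{nv} <= k as
   soon as nv + k e_1 dominates a point of C_o. Let f(s) = gamma(v + s e_1), with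
   gamma the homogeneous function whose nonpositive set is the cone C; by the
   shape theorem L_{nv} / n converges to the zero of f, provided that f crosses 0
   strictly, which holds if gamma(e_1) < 0, i.e. if e_1 is interior to C.

   This is where p < 1 enters. Walk from the origin by +e_1, inserting a step
   -e_j (j != 1) whenever the current site carries all the arrows. The walk meets
   a new hyperplane at each step, so it reads i.i.d. bits, and with probability
   bounded below it makes at least c n steps -e_j before time n, where
   c = (1 - p) / 2. Hence e_1 - c e_j lies in C; summing over j gives
   gamma(e_1) < 0. *)
Require Import Defs.
From mathcomp Require Import ring lra zify.

Set Implicit Arguments.
Unset Strict Implicit.
Unset Printing Implicit Defensive.

Local Open Scope classical_set_scope.
Local Open Scope ring_scope.

Lemma measure_bigsetU_le (R : realType) (disp : measure_display)
    (T : measurableType disp) (mu : {measure set T -> \bar R}) (I : Type)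
    (s : seq I) (Q : pred I) (F : I -> set T) :
  (forall i, measurable (F i)) ->
  (mu (\big[setU/set0]_(i <- s | Q i) F i) <= \sum_(i <- s | Q i) mu (F i))%E.
Proof.
move=> mF; elim: s => [|i s IH]; first by rewrite !big_nil measure0.
rewrite !big_cons; case: (Q i) => //; apply: le_trans (leeD2l _ IH).
by apply: measureU2 => //; exact: bigsetU_measurable.
Qed.

(** * Closure of the cluster under coordinatewise increase *)

Section Cluster.
Variables (d : nat).
Implicit Types (omega : environment d) (x y : site d) (i j : 'I_d).

Lemma C_o_origin omega : C_o omega 0.
Proof. by exists [::]. Qed.

Lemma C_o_step omega x y : C_o omega x -> y - x \in G omega x -> C_o omega y.
Proof.
move=> [s ps ->] Gxy; exists (rcons s y); last by rewrite last_rcons.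
by rewrite rcons_path ps.
Qed.

Lemma C_o_add_basis omega x i : C_o omega x -> C_o omega (x + delta_mx 0 i).
Proof.
move=> Cx; apply: (C_o_step Cx); rewrite addrC addKr inE /G.
by case: (omega x); [|left]; exists i.
Qed.

Lemma C_o_sub_basis omega x i :
  ~~ omega x -> C_o omega x -> C_o omega (x - delta_mx 0 i).
Proof.
move=> /negbTE ox Cx; apply: (C_o_step Cx); rewrite addrC addKr inE /G ox.
by right; exists i.
Qed.

(** Both values of [G] contain [E_plus], so the nonnegative difference can be walked one basis
    vector at a time in any environment. *)
Lemma C_o_up omega x y : (forall i, x 0 i <= y 0 i) -> C_o omega x -> C_o omega y.
Proof.
move=> xy Cx.
pose n_ i := absz (y 0 i - x 0 i)%R.
have -> : y = x + \sum_i delta_mx 0 i *+ n_ i.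
  apply/rowP => k; rewrite mxE summxE (bigD1 k)//= big1 ?addr0 => [|i ik].
    by rewrite mulmxnE mxE !eqxx/= mulr1n /n_ natz gez0_abs ?subr_ge0// subrKC.
  by rewrite mulmxnE mxE/= eq_sym (negbTE ik) mul0rn.
move: n_ => n_.
elim: index_enum x {xy} Cx => [|i s IH] x Cx; first by rewrite big_nil addr0.
rewrite big_cons addrA; apply: IH.
elim: (n_ i) => [|n IH]; first by rewrite addr0.
by rewrite mulrSr addrA; exact: C_o_add_basis.
Qed.

End Cluster.

(** * Law of the exploring walk *)

Section Exploration.
Variables (d : nat) (a j : 'I_d).
Hypothesis aj : a != j.
Implicit Types (omega : environment d) (b : seq bool).

(* The bits [b] read by the walk along its way, latest first: at [true] it steps
   by [e_a], at [false] by [- e_j] and then by [e_a]. Each visited site has its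
   own [a]-coordinate, which is why the bits read are independent. *)
Definition walk b : site d :=
  delta_mx 0 a *+ size b - delta_mx 0 j *+ count negb b.

Fixpoint history b : set (environment d) :=
  if b is c :: b' then [set omega | omega (walk b') = c] `&` history b' else setT.

Lemma C_o_walk omega b : history b omega -> C_o omega (walk b).
Proof.
elim: b => [|c b IH]; first by rewrite /walk mulr0n subrr => _; exact: C_o_origin.
move=> [/= oc /IH Cb].
have -> : walk (c :: b) = walk b - delta_mx 0 j *+ ~~ c + delta_mx 0 a.
  rewrite /walk/= mulrSr mulrnDr opprD [- _ - _]addrC addrACA -!addrA.
  by rewrite [_ + delta_mx 0 a]addrC.
apply: C_o_add_basis; case: c oc => oc /=; first by rewrite subr0.
by apply: C_o_sub_basis Cb; rewrite oc.
Qed.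

Fixpoint visited b : seq (site d) :=
  if b is _ :: b' then walk b' :: visited b' else [::].

Lemma walk_a b : walk b 0 a = (size b)%:Z.
Proof.
by rewrite !mxE !mulmxnE !mxE !eqxx/= (negbTE aj) mul0rn subr0 pmulrn intz.
Qed.

Lemma visited_lt b x : x \in visited b -> (x 0 a < (size b)%:Z).
Proof.
elim: b => //= c b IH; rewrite inE => /predU1P[->|/IH]; rewrite ?walk_a; lia.
Qed.

Lemma walk_notin b : walk b \notin visited b.
Proof. by apply/negP => /visited_lt; rewrite walk_a ltxx. Qed.

Lemma visited_uniq b : uniq (visited b).
Proof. by elim: b => //= c b ->; rewrite walk_notin. Qed.

(** The bit that [b] prescribes at a visited site; the final [true] is a default for all other
    sites. *)
Fixpoint bit b (x : site d) : bool :=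
  if b is c :: b' then if x == walk b' then c else bit b' x else true.

(** The visited sites are distinct, so the prescriptions never clash and the event takes the product
    form evaluated by [half_orthant_law]. *)
Lemma historyE b : history b =
  [set omega | forall x, x \in visited b -> [set bit b x] (omega x)].
Proof.
elim: b => [|c b IH]; first by apply/seteqP; split.
rewrite /= {}IH; apply/seteqP; split => omega /=.
  move=> [oc H] x; rewrite inE; case: eqP => [-> //|_ /= xb].
  exact: H.
move=> H; split=> [|x xb].
  by have := H (walk b); rewrite mem_head eqxx; exact.
have := H x; rewrite inE xb orbT => /(_ isT).
by case: eqP xb => // ->; rewrite (negbTE (walk_notin b)).
Qed.

Variables (R : realType) (p : R).
Hypothesis p01 : 0 <= p <= 1.
Variable P : probability (env_space d) R.
Hypothesis hP : half_orthant_law p P.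

Definition weight b : R := \prod_(c <- b) (if c then p else 1 - p).

Lemma history_prob b : P (history b) = (weight b)%:E.
Proof.
rewrite historyE (hP (fun x => [set bit b x]) (visited_uniq b)) /weight.
elim: b => [|c b IH]; first by rewrite !big_nil.
rewrite /= !big_cons eqxx EFinM; congr (_ * _)%E.
  rewrite bernoulli_probE// !diracE !in_set1.
  by case: c; rewrite /= !mule1 !mule0 ?adde0 ?add0e.
rewrite -IH; apply: eq_big_seq => x xb.
by case: eqP xb => // ->; rewrite (negbTE (walk_notin b)).
Qed.

Lemma history_measurable b : measurable (history b : set (env_space d)).
Proof.
elim: b => [|c b IH]; first exact: measurableT.
rewrite /=; apply: measurableI => //.
by apply: sub_sigma_algebra; exists (walk b), [set c].
Qed.

Fixpoint strings n : seq (seq bool) :=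
  if n is n'.+1 then map (cons true) (strings n') ++ map (cons false) (strings n')
  else [:: [::]].

Lemma strings_size n b : b \in strings n -> size b = n.
Proof.
elim: n b => [b|n IH b]; first by rewrite inE => /eqP ->.
by rewrite mem_cat => /orP[] /mapP[b' /IH <- ->].
Qed.

Lemma strings_cover omega n : exists2 b, b \in strings n & history b omega.
Proof.
elim: n => [|n [b bn hb]]; first by exists [::].
exists (omega (walk b) :: b) => //; rewrite mem_cat.
by case: (omega _); rewrite map_f ?orbT.
Qed.

Lemma weight_ge0 b : 0 <= weight b.
Proof. by case/andP: p01 => ? ?; apply: prodr_ge0 => -[] _ //; rewrite subr_ge0. Qed.

Lemma sum_weight n : \sum_(b <- strings n) weight b = 1.
Proof.
elim: n => [|n IH]; first by rewrite big_seq1 /weight big_nil.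
rewrite /= big_cat !big_map/= /weight.
under eq_bigr do rewrite big_cons.
under [X in _ + X]eq_bigr do rewrite big_cons.
by rewrite -!mulr_sumr IH; ring.
Qed.

(** Mean of a binomial count, by splitting on the latest bit. *)
Lemma sum_weight_count n :
  \sum_(b <- strings n) weight b * (count negb b)%:R = n%:R * (1 - p).
Proof.
elim: n => [|n IH]; first by rewrite big_seq1 /= mul0r mulr0.
rewrite /= big_cat !big_map/= /weight.
under eq_bigr do rewrite big_cons -mulrA.
under [X in _ + X]eq_bigr do rewrite big_cons natrD -mulrA mulrDr mulr1.
rewrite -!mulr_sumr big_split/= IH.
rewrite sum_weight -natr1; ring.
Qed.

Definition few_false (c : R) n : set (environment d) :=
  \big[setU/set0]_(b <- strings n | (count negb b)%:R < c * n%:R) history b.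

Lemma few_false_measurable c n : measurable (few_false c n : set (env_space d)).
Proof. by apply: bigsetU_measurable => b _; exact: history_measurable. Qed.

(* The number of [false] bits lies in [0, n] and has mean q n, q = 1 - p, so it
   is at least q n / 2 with probability at least q / 2. *)
Lemma few_false_prob n : (0 < n)%N ->
  (P (few_false ((1 - p) / 2) n) <= (1 - (1 - p) / 2)%:E)%E.
Proof.
move=> n0; pose q := 1 - p; rewrite -/q.
pose bad b := ((count negb b)%:R < q / 2 * n%:R :> R).
have : (P (few_false (q / 2) n) <= \sum_(b <- strings n | bad b) P (history b))%E.
  by apply: measure_bigsetU_le => b; exact: history_measurable.
move/le_trans; apply.
under eq_bigr do rewrite history_prob.
rewrite sumEFin lee_fin.
set beta := \sum_(b <- _ | _) _.
have beta_ge0 : 0 <= beta by apply: sumr_ge0 => b _; exact: weight_ge0.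
have nR : 0 < n%:R :> R by rewrite ltr0n.
have := sum_weight n; rewrite (bigID bad)/= -/beta => s1.
have := sum_weight_count n; rewrite (bigID bad)/= -/q => s2.
have le1 : \sum_(b <- strings n | bad b) weight b * (count negb b)%:R <=
    beta * (q / 2 * n%:R).
  rewrite mulr_suml; apply: ler_sum => b bb.
  by rewrite ler_wpM2l ?weight_ge0// ltW.
have le2 : \sum_(b <- strings n | ~~ bad b) weight b * (count negb b)%:R <=
    (1 - beta) * n%:R.
  have -> : 1 - beta = \sum_(b <- strings n | ~~ bad b) weight b.
    by apply/eqP; rewrite subr_eq addrC s1.
  rewrite mulr_suml big_seq_cond [leRHS]big_seq_cond.
  apply: ler_sum => b /andP[/strings_size <- _].
  by apply: ler_wpM2l; rewrite ?weight_ge0 // ler_nat count_size.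
have : n%:R * q <= (beta * (q / 2) + (1 - beta)) * n%:R.
  by rewrite -s2 mulrDl -mulrA lerD.
have : beta <= 1 by rewrite -[leRHS]s1 lerDl; apply: sumr_ge0 => b _; exact: weight_ge0.
rewrite mulrC ler_pM2r//; case/andP: p01; rewrite /q; nra.
Qed.

End Exploration.

(** The tail intersections [F N] increase to an event of probability 1, while [F N] is contained in
    [A N], of probability at most [b]. *)
Lemma ae_eventually_proba_ge1 (R : realType) (disp : measure_display)
    (T : measurableType disp) (P : probability T R) (A : nat -> set T) (b : R) :
  (forall n, measurable (A n)) ->
  (forall n, (0 < n)%N -> (P (A n) <= b%:E)%E) ->
  {ae P, forall t, \forall n \near \oo, A n t} -> 1 <= b.
Proof.
move=> mA Ab aeA; pose F N := \bigcap_(n in [set n | (N <= n)%N]) A n.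
have mF N : measurable (F N) by apply: bigcap_measurable => //; exists N => /=.
have mUF : measurable (\bigcup_N F N) by exact: bigcup_measurable.
have PUF : P (\bigcup_N F N) = 1%E.
  have : P (~` \bigcup_N F N) = 0%E.
    apply: measure_negligible; first exact: measurableC.
    apply: negligibleS aeA => t /= nF [N _ AN]; apply: nF; exists N => //.
  move=> H; rewrite -[X in P X]setCK probability_setC ?H ?sube0//.
  exact: measurableC.
have : (P \o F) x @[x --> \oo] --> P (\bigcup_N F N).
  apply: nondecreasing_cvg_mu => // n m nm; apply/subsetPset => t Fn k /= mk.
  by apply: Fn => /=; exact: leq_trans mk.
move=> cvF; suff : (P (\bigcup_N F N) <= b%:E)%E by rewrite PUF lee_fin.
rewrite -(cvg_lim _ cvF)//; apply: lime_le; first by apply/cvg_ex; eexists; exact: cvF.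
near=> N; have N0 : (0 < N)%N by near: N; exists 1.
by apply: le_trans (Ab _ N0); apply: le_measure; rewrite ?inE// => t; apply => /=.
Unshelve. all: by end_near. Qed.

Lemma box_coordP (R : realType) d (r : R) (x : 'rV[R]_d) : 0 <= r ->
  box r x <-> forall i, `|x 0 i| <= r.
Proof.
move=> r0; rewrite /box /= [X in X <= r]/Num.norm /= mx_normrE; split.
  move=> /bigmax_leP[_ H] i; exact: (H (0, i)).
by move=> H; apply/bigmax_leP; split=> // -[i j] _ /=; rewrite ord1.
Qed.

(** * Monotonicity of gamma and its values near the cone *)

Section Gamma.
Variables (R : realType) (d : nat) (g : 'rV[R]_d -> R).
Hypothesis hg : gamma_properties id g.
Implicit Types u w x : 'rV[R]_d.

Lemma gamma_sub_diag (r : R) u : 0 <= r -> g (u - r *: const_mx 1) = g u + r.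
Proof.
move=> r0; have := gamma_diagonal hg (u - r *: const_mx 1) r0.
by rewrite subrK => ->; rewrite subrK.
Qed.

Lemma gamma_anti u w : (forall i, u 0 i <= w 0 i) -> g w <= g u.
Proof.
move=> uw; rewrite -[w](subrKC u); apply: (le_trans (gamma_subadditive hg _ _)).
by rewrite gerDl; apply: (gamma_le0 hg) => i; rewrite !mxE subr_ge0.
Qed.

(** Adding [e] times the all-ones vector lifts [x] above a point of the cone and lowers [g] by
    exactly [e]. *)
Lemma gamma_box (e : R) x : 0 <= e ->
  minkowski (box e) [set z | g z <= 0] x -> g x <= e.
Proof.
move=> e0 [a /(box_coordP _ e0) ae [z /= gz <-]].
rewrite -subr_le0 -(gamma_diagonal hg _ e0); apply: le_trans gz.
apply: gamma_anti => i; rewrite !mxE.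
by have := ae i; rewrite ler_norml => /andP[]; lra.
Qed.

End Gamma.

(** * Strict negativity of gamma at a basis vector *)

Section Drift.
Variables (R : realType) (d : nat) (p : R) (P : probability (env_space d) R).
Hypothesis p01 : 0 <= p <= 1.
Hypothesis hP : half_orthant_law p P.
Variable g : 'rV[R]_d -> R.
Hypothesis hg : gamma_properties id g.
Hypothesis shape : forall epsilon r : R, 0 < epsilon -> 0 <= r ->
  {ae P, forall omega, \forall n \near \oo,
    box r `&` scaled_C_o omega n `<=` minkowski (box epsilon) [set z | g z <= 0]}.

(** Were [g] positive here, the shape theorem would almost surely rule out, for all large [n], walks
    with at least [c * n] bits [false]. Then [few_false] would hold eventually, although its
    probability is at most [1 - c < 1]. *)
Lemma gamma_tilted (a j : 'I_d) : a != j -> p < 1 ->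
  g (delta_mx 0 a - ((1 - p) / 2) *: delta_mx 0 j) <= 0.
Proof.
move=> aj p1; rewrite leNgt; apply/negP => g_gt0.
set c := (1 - p) / 2 in g_gt0 *; set u := _ - _ in g_gt0.
have c0 : 0 < c by rewrite /c; lra.
suff : 1 <= 1 - c by lra.
apply: (ae_eventually_proba_ge1 (P := P) (A := few_false a j c)).
- by move=> n; exact: few_false_measurable.
- by move=> n; exact: few_false_prob.
have e0 : 0 < g u / 2 by lra.
have := shape e0 ler01; apply: (@filterS _ _ (ae_filter_ringOfSetsType P)) => omega.
apply: filterS2 (nbhs_infty_gt 0) => n n0 sub.
have [b bn hb] := strings_cover a j omega n.
have sb := strings_size bn.
rewrite /few_false -bigcup_seq_cond; exists b => //=; rewrite bn /= ltNge.
apply/negP => cb.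
have nR : 0 < n%:R :> R by rewrite ltr0n.
have cbn : c <= (count negb b)%:R / n%:R by rewrite ler_pdivlMr.
have bn1 : (count negb b)%:R / n%:R <= 1 :> R.
  by rewrite ler_pdivrMr// mul1r ler_nat -sb count_size.
pose z : 'rV[R]_d := n%:R^-1 *: map_mx intr (walk a j b).
have zE i : z 0 i = (i == a)%:R - (count negb b)%:R / n%:R * (i == j)%:R.
  rewrite !mxE !mulmxnE !mxE/= sb rmorphB/= !rmorphMn/= mulr1z.
  rewrite -[_ *+ n]mulr_natr -[_ *+ count _ _]mulr_natr.
  by field; rewrite gt_eqF.
have : g z <= g u / 2.
  apply: (gamma_box hg); first exact: ltW.
  apply: sub; split; last by exists (walk a j b) => //; exact: C_o_walk.
  apply/(box_coordP _ ler01) => i; rewrite zE.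
  case: (eqVneq i a) => [->|_]; first by rewrite (negbTE aj) mulr0 subr0 normr1.
  case: (eqVneq i j) => _; rewrite ?mulr1 ?mulr0 sub0r normrN ?normr0//.
  by rewrite ger0_norm// (le_trans (ltW c0)).
(* At least [c * n] steps against [j] put [z] coordinatewise below [u]. *)
have : g u <= g z.
  apply: (gamma_anti hg) => i; rewrite zE !mxE lerD2l lerN2 eqxx/=.
  by rewrite ler_wpM2r.
lra.
Qed.

Lemma gamma_basis_lt0 (a : 'I_d) : p < 1 -> g (delta_mx 0 a) < 0.
Proof.
move=> p1; set c := (1 - p) / 2; have c0 : 0 < c by rewrite /c; lra.
pose w : 'rV[R]_d := \sum_(j | j != a) (delta_mx 0 a - c *: delta_mx 0 j).
have gw : g w <= 0.
  rewrite /w; elim/big_ind : _ => [|x y gx gy|j aj].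
  - by apply: (gamma_le0 hg) => i; rewrite mxE.
  - by apply: (le_trans (gamma_subadditive hg _ _)); lra.
  - by apply: gamma_tilted; rewrite // eq_sym.
(* Off [a] both vectors have entry [- c]; at [a] the entries are [d - c] and [d - 1], and
   [c <= 1]. *)
have le_w : g (d%:R *: delta_mx 0 a - c *: const_mx 1) <= g w.
  apply: (gamma_anti hg) => i; rewrite !mxE summxE/=.
  under eq_bigr do rewrite !mxE/=.
  have [->|ia] := eqVneq i a.
    rewrite (eq_bigr (fun=> 1)) => [|j /negbTE ja]; last first.
      by rewrite eq_sym ja mulr0 subr0.
    have : d%:R = \sum_(j < d) 1 :> R by rewrite sumr_const card_ord.
    by case/andP: p01 => ? ?; rewrite (bigD1 a)//= /c; lra.
  rewrite (bigD1 i)//=.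
  rewrite eqxx big1 => [|j /andP[_ ji]]; last by rewrite eq_sym (negbTE ji) mulr0 subr0.
  by rewrite mulr0 addr0 lexx.
have : g (d%:R *: delta_mx 0 a) <= - c.
  by have := gamma_sub_diag hg (d%:R *: delta_mx 0 a) (ltW c0); lra.
rewrite (gamma_homogeneous hg)// => dg.
rewrite ltNge; apply/negP => g0.
have : 0 <= d%:R * g (delta_mx 0 a) by rewrite mulr_ge0.
rewrite /= in dg *; lra.
Qed.

End Drift.

(** * The zero of gamma along a line *)

Section Crossing.
Variables (R : realType) (d : nat) (g : 'rV[R]_d -> R).
Hypothesis hg : gamma_properties id g.
Variables (a : 'I_d) (v : 'rV[R]_d).
Hypothesis ga : g (delta_mx 0 a) < 0.

Let f (s : R) := g (v + s *: delta_mx 0 a).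

Lemma gamma_line_decr s t : s < t -> f t < f s.
Proof.
move=> st; rewrite /f -(subrKC s t) scalerDl addrA.
apply: (le_lt_trans (gamma_subadditive hg _ _)).
rewrite (gamma_homogeneous hg) ?subr_ge0 ?ltW//= gtrDl.
by rewrite pmulr_rlt0// subr_gt0.
Qed.

Lemma gamma_line_crossing : exists zeta : R,
  (forall s, s < zeta -> 0 < f s) /\ (forall s, zeta < s -> f s < 0).
Proof.
pose S := [set s | f s <= 0].
(* At this parameter the coordinates sum to -1, so [f] is nonnegative there and strictly positive
   before it. *)
have lbS : lbound S (- dot v (const_mx 1) - 1).
  move=> s fs; rewrite leNgt; apply/negP => sv.
  have := gamma_line_decr sv; have : 0 <= f (- dot v (const_mx 1) - 1).
    apply: (gamma_ge0 hg).
    have -> : dot v (const_mx 1) = \sum_i v 0 i.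
      by apply: eq_bigr => i _; rewrite mxE mulr1.
    rewrite /dot.
    under eq_bigr do rewrite !mxE mulr1.
    rewrite big_split/= -mulr_sumr (bigD1 a (F := fun i => (i == a)%:R))//=.
    rewrite eqxx [X in _ + _ * (_ + X)]big1 => [|i /negbTE ->//].
    by rewrite addr0 mulr1 addrA subrr sub0r lerN10.
  by rewrite /S/= in fs; lra.
have S0 : S !=set0.
  (* Here the linear upper bound [g v + s * g (delta_mx 0 a)] is nonpositive. *)
  exists (`|g v| / - g (delta_mx 0 a)); apply: (le_trans (gamma_subadditive hg _ _)).
  rewrite (gamma_homogeneous hg)/=; last by rewrite divr_ge0// ltW// oppr_gt0.
  by rewrite invrN mulrN mulNr divfK ?lt_eqF// subr_le0 ler_norm.
have infS : has_inf S by split=> //; exists (- dot v (const_mx 1) - 1).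
exists (inf S); split=> s.
  move=> sS; rewrite ltNge; apply/negP => fs.
  by move: sS; rewrite ltNge ge_inf//; exists (- dot v (const_mx 1) - 1).
move=> /(inf_lt S0)[t ft ts]; apply: lt_le_trans ft; exact: gamma_line_decr.
Qed.

End Crossing.

Lemma e1_delta d (a : 'I_d) : a = 0%N :> nat -> e1 d = delta_mx 0 a.
Proof. by move=> a0; apply/rowP => i; rewrite !mxE -[i == a]val_eqE /= a0. Qed.

(** * Bounds on [L] from the two inclusions of the shape theorem *)

Section Bounds.
Variables (R : realType) (d : nat) (a : 'I_d) (v : site d).
Hypothesis a0 : a = 0%N :> nat.
Variables (g : 'rV[R]_d -> R) (omega : environment d).
Hypothesis hg : gamma_properties id g.

Let vR : 'rV[R]_d := map_mx intr v.
Let f s := g (vR + s *: delta_mx 0 a).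

Lemma box_line (s b : R) : `|s| <= b -> box (`|vR| + b) (vR + s *: delta_mx 0 a).
Proof.
move=> sb; have b0 := le_trans (normr_ge0 s) sb.
apply: (le_trans (ler_normD _ _)); rewrite lerD2l.
apply/(box_coordP _ b0) => i; rewrite !mxE eqxx/=.
by case: (i == a); rewrite ?mulr1 ?mulr0 ?normr0.
Qed.

Lemma scaled_line (n : nat) (k : int) : (0 < n)%N ->
  n%:R^-1 *: map_mx intr (v *+ n + k *: e1 d) =
  vR + (k%:~R / n%:R) *: delta_mx 0 a :> 'rV[R]_d.
Proof.
move=> n0; have nR : n%:R != 0 :> R by rewrite pnatr_eq0 -lt0n.
apply/rowP => i; rewrite (e1_delta a0) !mxE mulmxnE eqxx/=.
rewrite rmorphD/= rmorphMn/= rmorphM/= -[_ *+ n]mulr_natr.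
by case: (i == a); rewrite /= ?mulr1z ?mulr0z; field.
Qed.

(** The shape theorem controls bounded boxes only, and [k] may be very negative. Upward closure
    replaces it by the floor [k'] of [n * s], whose scaled point stays in the box and has [g] at
    least [f s], too large for the inclusion. *)
Lemma L_ge (s b : R) (n : nat) : (0 < n)%N -> 1 <= n%:R * b -> 0 <= b ->
  0 < f s -> (forall t, t < s -> f s <= f t) ->
  box (`|vR| + (`|s| + b)) `&` scaled_C_o omega n `<=`
    minkowski (box (f s / 2)) [set z | g z <= 0] ->
  ((n%:R * s)%:E <= L R omega (v *+ n))%E.
Proof.
move=> n0 nb b0 fs fmon sub; have nR : 0 < n%:R :> R by rewrite ltr0n.
apply: le_ereal_inf_tmp => _ [k /= Ck <-]; rewrite lee_fin leNgt; apply/negP => kns.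
pose k' := Num.floor (n%:R * s); pose t : R := k'%:~R / n%:R.
have kk' : k <= k' by rewrite /k' floor_ge_int; exact: ltW.
have ts : t <= s by rewrite ler_pdivrMr// mulrC floor_le.
have tb : s - b <= t.
  rewrite ler_pdivlMr// mulrBl; have := floorD1_gt (n%:R * s).
  rewrite intrD -/k'; lra.
have : g (vR + t *: delta_mx 0 a) <= f s / 2.
  apply: (gamma_box hg); first lra.
  apply: sub; split.
    apply: box_line; rewrite ler_norml.
    by have := ler_norm s; have := ler_norm (- s); rewrite normrN; lra.
  rewrite -scaled_line//; exists (v *+ n + k' *: e1 d) => //.
  apply: C_o_up Ck => i; rewrite (e1_delta a0) !mxE lerD2l ler_wpM2r// ?ler0n//.
have : f s <= f t by move: ts; rewrite le_eqVlt => /predU1P[->|/fmon].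
rewrite -/(f t); lra.
Qed.

(** Lowering the point of the line along the diagonal by [- f s] gives [z] with [g z = 0]. A scaled
    cluster point within [- f s] of [z] is still below the point of the line, so upward closure
    applies. *)
Lemma L_le (s : R) (n : nat) : (0 < n)%N -> f s < 0 ->
  let z := vR + s *: delta_mx 0 a + f s *: const_mx 1 in
  box `|z| `&` [set z | g z <= 0] `<=`
    minkowski (box (- f s)) (scaled_C_o omega n) ->
  (L R omega (v *+ n) <= (n%:R * s + 1)%:E)%E.
Proof.
move=> n0 fs z sub; have nR : 0 < n%:R :> R by rewrite ltr0n.
have fs0 : 0 <= - f s by rewrite oppr_ge0 ltW.
have zC : g z <= 0.
  rewrite /z -[f s]opprK scaleNr (gamma_sub_diag hg)// -/(f s); lra.
have [//|u ub [_ [x Cx <-] uz]] := sub z.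
  by split=> //; rewrite /box /=.
(* An integer strictly above [n * s]; this rounding costs the [+ 1]. *)
pose k := Num.floor (n%:R * s) + 1.
apply: (@le_trans _ _ (k%:~R)%:E); last first.
  by rewrite lee_fin intrD lerD2r floor_le.
apply: ereal_inf_lbound; exists k => //=.
apply: C_o_up Cx => i; rewrite -(ler_int R).
move/(box_coordP _ fs0) : ub => /(_ i); rewrite ler_norml opprK => /andP[ui _].
move/rowP : uz => /(_ i); rewrite (e1_delta a0) !mxE mulmxnE eqxx/= => uz.
have : (x 0 i)%:~R <= n%:R * ((v 0 i)%:~R + s * (i == a)%:R) :> R.
  rewrite -ler_pdivrMl//; lra.
move/le_trans; apply.
rewrite rmorphD/= rmorphMn/= rmorphM/= mulrDr mulr_natl lerD2l mulrA.
have := floorD1_gt (n%:R * s); rewrite -/k.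
by case: (i == a); rewrite /= ?mulr1z ?mulr0z; lra.
Qed.

End Bounds.

(** * From two-sided bounds to almost sure convergence *)

Lemma cvge_squeeze_mul (R : realType) (u : nat -> \bar R) (zeta : R) :
  (forall m : nat, \forall n \near \oo,
    (((n%:R * (zeta - m.+1%:R^-1))%:E <= u n) &&
     (u n <= (n%:R * (zeta + m.+1%:R^-1))%:E))%E) ->
  (fun n : nat => (n%:R^-1)%:E * u n)%E @ \oo --> zeta%:E.
Proof.
move=> H.
have bnd (m : nat) : \forall n \near \oo, ((n%:R^-1)%:E * u n)%E \is a fin_num
   /\ (`|zeta - fine ((n%:R^-1)%:E * u n)%E| <= m.+1%:R^-1)%R.
  apply: filterS2 (H m) (nbhs_infty_gt 0) => n + n0.
  have nR : 0 < n%:R :> R by rewrite ltr0n.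
  (* The finite bounds exclude infinite values of [u n]. *)
  case: (u n) => [x| |] /=; rewrite ?leey ?leye_eq ?leNye ?leeNy_eq ?andbF//.
  rewrite !lee_fin -(ler_pdivrMl _ _ nR) -(ler_pdivlMl _ _ nR) => /andP[l r]; split => //.
  by move: m.+1%:R^-1 l r => c l r; rewrite ler_norml; apply/andP; split; lra.
apply/fine_cvgP; split; first by apply: filterS (bnd 0%N) => n [].
apply/cvgrPdist_le => e e0.
have := near_infty_natSinv_lt (PosNum e0) => -[m _ /(_ m (leqnn m)) /= me].
by apply: filterS (bnd m) => n [_ /le_trans]; apply; exact: ltW.
Qed.

Theorem corollary1 (R : realType) (d : nat) (hd : (2 <= d)%N)
    (p1 : R) (hp1 : shape_threshold d p1)
    (p : R) (p_ge0 : 0 <= p) (p_gt : p1 < p) (p_lt1 : p < 1)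
    (P : probability (env_space d) R) (hP : half_orthant_law p P)
    (v : 'rV[int]_d) (hv : dot v (e1 d) = 0) :
  exists zeta : R, {ae P, forall omega,
    (fun n : nat => (n%:R^-1)%:E * L R omega (v *+ n))%E @ \oo --> zeta%:E}.
Proof.
pose a : 'I_d := Ordinal (ltnW hd); have a0 : a = 0%N :> nat by [].
have p01 : 0 <= p <= 1 by rewrite p_ge0 ltW.
have [_ /(_ p p01 p_gt P hP) [_ [g [_ _ [_ _ hg] _ shape]]]] := hp1.
have aeF := ae_filter_ringOfSetsType P.
have ga : g (delta_mx 0 a) < 0.
  apply: (gamma_basis_lt0 p01 hP hg) => // epsilon r e0 r0.
  by have := shape _ _ e0 r0; apply: filterS => omega; apply: filterS => n [].
have [zeta [pos neg]] := gamma_line_crossing hg (map_mx intr v) ga.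
exists zeta.
set f := fun s => g (map_mx intr v + s *: delta_mx 0 a).
(* Countably many tolerances suffice, so the exceptional null sets can be united. *)
suff : forall m : nat, {ae P, forall omega, \forall n \near \oo,
    (((n%:R * (zeta - m.+1%:R^-1))%:E <= L R omega (v *+ n)) &&
     (L R omega (v *+ n) <= (n%:R * (zeta + m.+1%:R^-1))%:E))%E}.
  move=> /ae_foralln; apply: filterS => omega; exact: cvge_squeeze_mul.
move=> m; set del : R := m.+1%:R^-1.
have del0 : 0 < del by rewrite invr_gt0.
have fl : 0 < f (zeta - del) by apply: pos; lra.
(* Only half of [del] is spent here; the other half absorbs the [+ 1] of [L_le] once
   [n * del / 2 >= 1]. *)
have fr : f (zeta + del / 2) < 0 by apply: neg; lra.
set z : 'rV[R]_d := map_mx intr v + (zeta + del / 2) *: delta_mx 0 a +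
  f (zeta + del / 2) *: const_mx 1.
have eps_lo : 0 < f (zeta - del) / 2 by lra.
have eps_up : 0 < - f (zeta + del / 2) by lra.
have r_lo : 0 <= `|map_mx intr v : 'rV[R]_d| + (`|zeta - del| + del).
  by rewrite !addr_ge0// ltW.
apply: filterS2 (shape _ _ eps_lo r_lo) (shape _ _ eps_up (normr_ge0 z)) => omega lo up.
apply: filterS3 (nbhs_infty_ge (Num.truncn (2 / del)).+1) lo up.
move=> n nlarge [lo _] [_ up].
have n0 : (0 < n)%N := leq_trans (ltn0Sn _) nlarge.
have nd : 1 <= n%:R * (del / 2).
  rewrite -ler_pdivrMr ?divr_gt0// mul1r invf_div.
  by apply/ltW/(lt_le_trans (truncnS_gt _)); rewrite ler_nat.
apply/andP; split.
  apply: (L_ge a0 hg n0 (b := del)) => //; [lra|exact: ltW|].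
  by move=> t ts; apply/ltW/(gamma_line_decr hg _ ga).
apply: le_trans (L_le a0 hg n0 fr _) _; last by rewrite lee_fin; lra.
exact: up.
Qed.
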